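(* Let $0<\alpha\le\infty$. If $f\in S_{\mathrm{mono}}^{(3)}(-\alpha,\alpha)$, then $f$ is continuously differentiable on $(-\alpha,\alpha)$.
   Context: For a real function $f$ on $(-\alpha,\alpha)$ and a real matrix $A=[a_{ij}]$ with all entries in $(-\alpha,\alpha)$, $f[A]:=[f(a_{ij})]$. For real symmetric matrices, $A\ge0$ means positive semidefinite, and $A\ge B$ means $A-B\ge0$. $S_{\mathrm{mono}}^{(n)}(-\alpha,\alpha)$ is the set of real functions $f$ on $(-\alpha,\alpha)$ such that $A\ge B\ge0$ implies $f[A]\ge f[B]$ for all symmetric $A,B\in M_n(\mathbb{R})$ with entries in $(-\alpha,\alpha)$. *)

(* Defs.v *)
From HB Require Import structures.
From mathcomp Require Import all_boot all_order all_algebra.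
From mathcomp Require Import sesquilinear.
From mathcomp Require Import all_classical all_reals all_analysis.

Set Implicit Arguments.
Unset Strict Implicit.
Unset Printing Implicit Defensive.

Import Order.TTheory GRing.Theory Num.Theory.
Import numFieldNormedType.Exports.

Local Open Scope classical_set_scope.
Local Open Scope ring_scope.

Definition sym_itv (R : realType) (alpha : \bar R) : set R :=
  [set x | (- alpha < x%:E < alpha)%E].

Definition psdmx (R : realType) (n : nat) (A : 'M[R]_n) : Prop :=
  A \is symmetricmx /\ forall x : 'cV[R]_n, 0 <= (x^T *m A *m x) 0 0.

Definition loewner_ge (R : realType) (n : nat) (A B : 'M[R]_n) : Prop :=
  psdmx (A - B).

Definition entries_in (R : realType) (n : nat) (D : set R) (A : 'M[R]_n) :
    Prop :=
  forall i j, D (A i j).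

(* A function on (-alpha, alpha) is represented by a total f : R -> R whose
   values outside the interval are irrelevant; the entrywise f[A] is
   map_mx f A. *)
Definition Smono (R : realType) (n : nat) (alpha : \bar R) : set (R -> R) :=
  [set f | forall A B : 'M[R]_n,
    A \is symmetricmx -> B \is symmetricmx ->
    entries_in (sym_itv alpha) A -> entries_in (sym_itv alpha) B ->
    loewner_ge A B -> loewner_ge B 0 ->
    loewner_ge (map_mx f A) (map_mx f B)].

(* Meant for open D, where derivability at a point of D depends only on the
   restriction of f to D. *)
Definition continuously_differentiable_on (R : realType) (D : set R)
    (f : R -> R) : Prop :=
  (forall x, D x -> derivable f x 1) /\ {within D, continuous (f^`())%classic}.

(* Main.v *)
Require Import Defs.
From mathcomp Require Import all_boot all_order all_algebra.
From mathcomp Require Import sesquilinear ring lra.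
From mathcomp Require Import all_classical all_reals all_analysis.

Set Implicit Arguments.
Unset Strict Implicit.
Unset Printing Implicit Defensive.

Import Order.TTheory GRing.Theory Num.Theory.
Import numFieldNormedType.Exports.

Local Open Scope classical_set_scope.
Local Open Scope ring_scope.

(** The idea is to study the increments D_e(x) = f(x + e) - f(x), for e > 0.
    If B is a positive semidefinite 3 x 3 matrix and J the all-ones matrix,
    then B + e J >= B >= 0, so monotonicity of f says that D_e[B] is positive
    semidefinite ([increment_form]): D_e preserves positivity, and this for
    every small e, without any regularity of f being known.

    Two-dimensional B give |D_e(x)| <= D_e(y) for |x| <= y
    ([norm_increment_le]).  So D_e is nonnegative and nondecreasing on the
    positive half-line, and a telescoping argument yields a bound
    |D_e| <= M e that is uniform in e ([increment_le]).

    A genuinely three-dimensional B, with rows (d, x, x'), (x, b, y),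
    (x', y, b), compares increments at arbitrary points x and x' of [-c, c]
    with those at points of the positive half-line: it gives
      0 <= D_e(d) s^2 + 2 (D_e(x) - D_e(x')) s + 2 (D_e(b) - D_e(y))
    for all real s, as soon as (x - x')^2 <= 2 (d - c) (b - y)
    ([increment_quadratic_ge0]).  Letting (y, b) run through the n intervals
    of a regular grid of [c, d] and adding up, the last terms telescope;
    choosing n of order (x - x')^(-2) and s of order |x - x'| gives
      |D_e(x) - D_e(x')| <= K e |x - x'|
    on [-c, c], with K independent of e ([increment_lipschitz]).

    So the difference quotients D_e / e are K-Lipschitz uniformly in e.  Since
    the quotient over a step n e is the mean of n quotients over the step e at
    neighbouring points, quotients over different small steps differ by
    little; they form a Cauchy family as the step goes to 0 ([slope_cauchy]),
    and f is differentiable.  The derivative inherits the Lipschitz constant K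
    ([derive_lipschitz]), so it is continuous, and even locally Lipschitz. *)

(** * Three-by-three matrices and the increments of f *)

Definition increment (R : realType) (f : R -> R) (e x : R) : R :=
  f (x + e) - f x.

Definition mx3 (R : realType) (d x x' b y : R) : 'M[R]_3 :=
  \matrix_(i, j)
    nth 0 (nth [::] [:: [:: d; x; x']; [:: x; b; y]; [:: x'; y; b]] i) j.

(** The quadratic form of [mx3 d x x' b y] at the vector (s, t, u). *)
Definition form3 (R : realType) (d x x' b y s t u : R) : R :=
  d * s ^+ 2 + b * (t ^+ 2 + u ^+ 2) + 2 * x * s * t + 2 * x' * s * u
  + 2 * y * t * u.

Lemma mx3_sym (R : realType) (d x x' b y : R) :
  mx3 d x x' b y \is symmetricmx.
Proof.
rewrite is_hermitianmxE expr0 scale1r; apply/eqP/matrixP => i j.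
rewrite !mxE; case: i => [[|[|[|//]]]] ?; case: j => [[|[|[|//]]]] ? //=.
Qed.

Lemma mx3_form (R : realType) (d x x' b y : R) (v : 'cV[R]_3) :
  (v^T *m mx3 d x x' b y *m v) 0 0 =
  form3 d x x' b y (v 0 0) (v 1 0) (v 2 0).
Proof.
rewrite !mxE !big_ord_recl !big_ord0 !mxE !big_ord_recl !big_ord0 !mxE /=.
have -> : lift ord0 ord0 = 1 :> 'I_3 by apply/val_inj.
have -> : lift ord0 (lift ord0 ord0) = 2 :> 'I_3 by apply/val_inj.
have -> : ord0 = 0 :> 'I_3 by apply/val_inj.
by rewrite /form3 /=; ring.
Qed.

Lemma psd_mx3 (R : realType) (d x x' b y : R) :
  psdmx (mx3 d x x' b y) <-> forall s t u, 0 <= form3 d x x' b y s t u.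
Proof.
split=> [[_ P] s t u|P].
  have := P (\col_i nth 0 [:: s; t; u] i).
  by rewrite mx3_form !mxE /=.
by split; [exact: mx3_sym|move=> v; rewrite mx3_form].
Qed.

Lemma mx3B (R : realType) (d x x' b y e z z' c w : R) :
  mx3 d x x' b y - mx3 e z z' c w =
  mx3 (d - e) (x - z) (x' - z') (b - c) (y - w).
Proof.
apply/matrixP => i j; rewrite !mxE.
by case: i => [[|[|[|//]]]] ?; case: j => [[|[|[|//]]]] ?.
Qed.

Lemma map_mx3 (R : realType) (f : R -> R) (d x x' b y : R) :
  map_mx f (mx3 d x x' b y) = mx3 (f d) (f x) (f x') (f b) (f y).
Proof.
apply/matrixP => i j; rewrite !mxE.
by case: i => [[|[|[|//]]]] ?; case: j => [[|[|[|//]]]] ?.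
Qed.

Lemma sym_itv_le (R : realType) (alpha : \bar R) (z x : R) :
  (z%:E < alpha)%E -> `|x| <= z -> sym_itv alpha x.
Proof.
move=> za; rewrite ler_norml => /andP[zx xz].
rewrite /sym_itv /=; apply/andP; split.
  rewrite lteNl (le_lt_trans _ za)// lee_fin; lra.
by rewrite (le_lt_trans _ za).
Qed.

Lemma mx3_entries (R : realType) (D : set R) (d x x' b y : R) :
  D d -> D x -> D x' -> D b -> D y -> entries_in D (mx3 d x x' b y).
Proof.
move=> Dd Dx Dx' Db Dy i j; rewrite !mxE.
by case: i => [[|[|[|//]]]] ?; case: j => [[|[|[|//]]]] ?.
Qed.

(** For B positive semidefinite, B + e J >= B >= 0, where J is the all-ones
    matrix; monotonicity then says that f[B + e J] - f[B] >= 0, and this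
    matrix is the increment of f applied entrywise to B.  This is the only
    place where the monotonicity of f is used. *)
Lemma increment_form (R : realType) (alpha : \bar R) (f : R -> R)
    (e z d x x' b y : R) :
  Smono 3 alpha f -> 0 <= e -> ((z + e)%:E < alpha)%E ->
  `|d| <= z -> `|x| <= z -> `|x'| <= z -> `|b| <= z -> `|y| <= z ->
  (forall s t u, 0 <= form3 d x x' b y s t u) ->
  forall s t u, 0 <= form3 (increment f e d) (increment f e x)
    (increment f e x') (increment f e b) (increment f e y) s t u.
Proof.
move=> fm e0 za dz xz x'z bz yz pos.
have za' : (z%:E < alpha)%E.
  by rewrite (le_lt_trans _ za)// lee_fin lerDl.
have shiftz w : `|w| <= z -> `|w + e| <= z + e.
  by move=> wz; rewrite (le_trans (ler_normD _ _))// (ger0_norm e0) lerD2r.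
apply/psd_mx3; rewrite /increment -mx3B -!map_mx3.
apply: fm.
- exact: mx3_sym.
- exact: mx3_sym.
- by apply: mx3_entries; apply: (sym_itv_le za); apply: shiftz.
- by apply: mx3_entries; apply: (sym_itv_le za').
- have addeK w : w + e - w = e by ring.
  rewrite /loewner_ge mx3B !addeK.
  apply/psd_mx3 => s t u.
  have -> : form3 e e e e e s t u = e * (s + t + u) ^+ 2.
    by rewrite /form3; ring.
  by rewrite mulr_ge0// sqr_ge0.
- by rewrite /loewner_ge subr0; apply/psd_mx3.
Qed.

Lemma sqr_ler_norm (R : realType) (x y : R) : `|x| <= y -> x ^+ 2 <= y ^+ 2.
Proof.
move=> xy; rewrite -real_normK ?num_real//.
by rewrite lerXn2r ?nnegrE ?(le_trans _ xy).
Qed.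

Lemma binary_form_ge0 (R : realType) (a b c p q : R) :
  0 < a -> b ^+ 2 <= 4 * a * c -> 0 <= a * p ^+ 2 + b * p * q + c * q ^+ 2.
Proof.
move=> a0 bac.
have a40 : 0 < 4 * a by lra.
rewrite -(pmulr_rge0 _ a40).
have -> : 4 * a * (a * p ^+ 2 + b * p * q + c * q ^+ 2) =
  (2 * a * p + b * q) ^+ 2 + (4 * a * c - b ^+ 2) * q ^+ 2 by ring.
apply: addr_ge0; first exact: sqr_ge0.
by apply: mulr_ge0; rewrite ?sqr_ge0// subr_ge0.
Qed.

(** The increments have the domination property of a function preserving
    positivity of [[y, x], [x, y]]; duplicating the second row and column
    places this matrix in the family [mx3].  Taking x >= 0, it also says that
    increments are nonnegative and nondecreasing on [0, alpha). *)
Lemma norm_increment_le (R : realType) (alpha : \bar R) (f : R -> R)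
    (e x y : R) :
  Smono 3 alpha f -> 0 <= e -> ((y + e)%:E < alpha)%E -> `|x| <= y ->
  `|increment f e x| <= increment f e y.
Proof.
move=> fm e0 ya xy.
have yy : `|y| <= y by rewrite ger0_norm// (le_trans _ xy).
have pos s t u : 0 <= form3 y x x y y s t u.
  have -> : form3 y x x y y s t u
    = y * s ^+ 2 + 2 * x * s * (t + u) + y * (t + u) ^+ 2.
    by rewrite /form3; ring.
  (* [binary_form_ge0] wants a positive first coefficient; y <= 0 forces
     x = y = 0. *)
  have [y0|y0] := leP y 0.
    have -> : y = 0 by apply/eqP; rewrite eq_le y0 (le_trans _ xy).
    have -> : x = 0 by apply/eqP; rewrite -normr_le0 (le_trans xy).
    by rewrite !(mul0r, mulr0) !addr0.
  apply: binary_form_ge0 => //.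
  by have := sqr_ler_norm xy; nra.
have P := increment_form fm e0 ya yy xy xy yy yy pos.
have := P 1 1 0; have := P 1 (-1) 0; rewrite /form3 => *.
by rewrite ler_norml; apply/andP; split; lra.
Qed.

(** Integer approximation up to a factor 2, so that 1 / n is comparable with
    1 / t; this is all the precision needed below. *)
Lemma truncn_half (R : realType) (t : R) :
  1 <= t -> exists n : nat, [/\ (0 < n)%N, n%:R <= t & t <= 2 * n%:R].
Proof.
move=> t1; have /truncn_itv/andP[nt tn] : 0 <= t by lra.
exists (Num.truncn t).
have n0 : (0 < Num.truncn t)%N by rewrite truncn_gt0.
have n1 : 1 <= (Num.truncn t)%:R :> R by rewrite ler1n.
by split => //; rewrite -natr1 in tn; lra.
Qed.

Lemma increment_telescope (R : realType) (f : R -> R) (e x : R) (n : nat) :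
  \sum_(0 <= k < n) increment f e (x + k%:R * e) = increment f (n%:R * e) x.
Proof.
rewrite /increment.
transitivity (\sum_(0 <= k < n) (f (x + k.+1%:R * e) - f (x + k%:R * e))).
  by apply: eq_bigr => k _; rewrite -natr1 mulrDl mul1r addrA.
by rewrite (telescope_sumr (fun k => f (x + k%:R * e)))// mul0r addr0.
Qed.

(** Increments are nondecreasing to the right of d, so n steps of length e
    starting at d increase f by at least n times the first step, and they
    stay inside [d, d + e0]; n is the integer part of e0 / e, which costs the
    factor 2. *)
Lemma increment_le (R : realType) (alpha : \bar R) (f : R -> R)
    (e0 e d : R) :
  Smono 3 alpha f -> 0 <= d -> ((d + e0)%:E < alpha)%E -> 0 < e <= e0 ->
  increment f e d <= 2 * increment f e0 d / e0 * e.
Proof.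
move=> fm d0 da /andP[ep ee0].
have e0p : 0 < e0 by exact: lt_le_trans ep ee0.
have lt_alpha w : w <= d + e0 -> (w%:E < alpha)%E.
  by move=> wd; rewrite (le_lt_trans _ da).
have [n [n0 ne en]] : exists n : nat,
    [/\ (0 < n)%N, n%:R <= e0 / e & e0 / e <= 2 * n%:R].
  by apply: truncn_half; rewrite ler_pdivlMr// mul1r.
move: ne en; rewrite ler_pdivlMr// ler_pdivrMr// => ne en.
have nR : 0 < n%:R :> R by rewrite ltr0n.
have mono_n : n%:R * increment f e d <= increment f (n%:R * e) d.
  rewrite -increment_telescope mulr_natl -[X in _ *+ X]subn0 -sumr_const_nat.
  rewrite big_seq [leRHS]big_seq; apply: ler_sum => k.
  rewrite mem_index_iota => /andP[_ kn].
  have kn' : k%:R * e + e <= n%:R * e.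
    by rewrite -[X in _ + X]mul1r -mulrDl natr1 ler_pM2r// ler_nat.
  have ke : 0 <= k%:R * e by rewrite mulr_ge0 ?ler0n// ltW.
  have := @norm_increment_le _ _ _ e d (d + k%:R * e) fm (ltW ep).
  rewrite ger0_norm// lerDl => /(_ _ ke) H.
  apply: le_trans (ler_norm _) (H _).
  by apply: lt_alpha; lra.
have mono_e0 : increment f (n%:R * e) d <= increment f e0 d.
  have := @norm_increment_le _ _ _ (e0 - n%:R * e) (d + n%:R * e)
    (d + n%:R * e) fm.
  rewrite subr_ge0 ne ger0_norm; last by rewrite addr_ge0// mulr_ge0 // ltW.
  rewrite lexx => /(_ isT) H.
  have {H} := le_trans (normr_ge0 _) (H _ isT).
  rewrite -addrA [n%:R * e + _]addrC subrK => /(_ da).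
  by rewrite /increment -addrA [n%:R * e + _]addrC subrK; lra.
have i0 : 0 <= increment f e0 d.
  apply: le_trans (normr_ge0 _)
    (@norm_increment_le _ _ _ e0 d d fm (ltW e0p) da _).
  by rewrite ger0_norm.
rewrite -(ler_pM2l nR) (le_trans (le_trans mono_n mono_e0))//.
have -> : n%:R * (2 * increment f e0 d / e0 * e) =
  increment f e0 d * (2 * n%:R * e / e0) by ring.
by rewrite ler_peMr// ler_pdivlMr// mul1r.
Qed.

(** The three-dimensional step.  With p = t + u and q = t - u the form of
    [mx3 d x x' b y] at (r, t, u) splits as a form in (r, p), positive because
    |x|, |x'| <= c <= y <= b, plus the form
      (d - c) r^2 + (x - x') r q + ((b - y) / 2) q^2,
    positive because of the hypothesis on (x - x')^2.  Evaluating the form of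
    the increments at (s, 1, -1) then controls the difference of the
    increments at x and x' by the difference of those at b and y, two points
    of the positive half-line. *)
Lemma increment_quadratic_ge0 (R : realType) (alpha : \bar R) (f : R -> R)
    (e c d x x' b y s : R) :
  Smono 3 alpha f -> 0 <= e -> ((d + e)%:E < alpha)%E ->
  0 < c -> c < d -> `|x| <= c -> `|x'| <= c -> c <= y -> y <= b -> b <= d ->
  (x - x') ^+ 2 <= 2 * (d - c) * (b - y) ->
  0 <= increment f e d * s ^+ 2
       + 2 * (increment f e x - increment f e x') * s
       + 2 * (increment f e b - increment f e y).
Proof.
move=> fm e0 da c0 cd xc x'c cy yb bd xx'.
have dn : `|d| <= d by rewrite ger0_norm//; lra.
have xn : `|x| <= d by lra.
have x'n : `|x'| <= d by lra.
have bn : `|b| <= d by rewrite ger0_norm//; lra.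
have yn : `|y| <= d by rewrite ger0_norm//; lra.
have pos r t u : 0 <= form3 d x x' b y r t u.
  have -> : form3 d x x' b y r t u =
    (c * r ^+ 2 + (x + x') * r * (t + u) + (b + y) / 2 * (t + u) ^+ 2) +
    ((d - c) * r ^+ 2 + (x - x') * r * (t - u) + (b - y) / 2 * (t - u) ^+ 2).
    by rewrite /form3; field.
  apply: addr_ge0; apply: binary_form_ge0; [lra | | lra | lra].
  have /sqr_ler_norm : `|x + x'| <= 2 * c.
    by rewrite (le_trans (ler_normD _ _))//; lra.
  by nra.
have := increment_form fm e0 da dn xn x'n bn yn pos s 1 (-1).
by rewrite /form3; congr (0 <= _); ring.
Qed.

(** Summing the preceding inequality over the consecutive pairs
    (y, b) = (c + k h, c + (k + 1) h) of the grid of step h = (d - c) / n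
    telescopes the last term into a single difference of increments between
    d and c; the increment at c is nonnegative and can be dropped.  Compared
    with one use of the inequality, this improves that term by a factor n. *)
Lemma increment_quadratic_sum_ge0 (R : realType) (alpha : \bar R) (f : R -> R)
    (e c d x x' s : R) (n : nat) :
  Smono 3 alpha f -> 0 <= e -> ((d + e)%:E < alpha)%E ->
  0 < c -> c < d -> `|x| <= c -> `|x'| <= c -> (0 < n)%N ->
  n%:R * (x - x') ^+ 2 <= 2 * (d - c) ^+ 2 ->
  0 <= n%:R * (increment f e d * s ^+ 2
               + 2 * (increment f e x - increment f e x') * s)
       + 2 * increment f e d.
Proof.
move=> fm e0 da c0 cd xc x'c n0 xx'.
have nR : 0 < n%:R :> R by rewrite ltr0n.
pose h := (d - c) / n%:R.
have h0 : 0 < h by rewrite divr_gt0// subr_gt0.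
have nh : n%:R * h = d - c by rewrite /h mulrC divfK// gt_eqF.
have ic : 0 <= increment f e c.
  have ca : ((c + e)%:E < alpha)%E.
    by rewrite (le_lt_trans _ da)// lee_fin lerD2r ltW.
  apply: le_trans (normr_ge0 _) (@norm_increment_le _ _ _ e c c fm e0 ca _).
  by rewrite ger0_norm// ltW.
pose p k := c + k%:R * h.
have pS k : p k.+1 = p k + h by rewrite /p -natr1; ring.
have term k : (k < n)%N -> 0 <= increment f e d * s ^+ 2
       + 2 * (increment f e x - increment f e x') * s
       + 2 * (increment f e (p k.+1) - increment f e (p k)).
  move=> kn; apply: (increment_quadratic_ge0 s fm e0 da c0 cd xc x'c).
  - by rewrite lerDl mulr_ge0// ltW.
  - by rewrite pS lerDl ltW.
  - have : k.+1%:R * h <= n%:R * h by rewrite ler_pM2r// ler_nat.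
    by rewrite nh /p; lra.
  - have -> : p k.+1 - p k = h by rewrite pS; ring.
    by rewrite -(ler_pM2l nR) (le_trans xx')// [leRHS]mulrCA nh expr2 mulrA.
have : 0 <= \sum_(0 <= k < n) (increment f e d * s ^+ 2
       + 2 * (increment f e x - increment f e x') * s
       + 2 * (increment f e (p k.+1) - increment f e (p k))).
  rewrite big_seq; apply: sumr_ge0 => k.
  by rewrite mem_index_iota => /andP[_ kn]; exact: term.
rewrite big_split /= sumr_const_nat subn0 -mulr_sumr.
rewrite (telescope_sumr (fun k => increment f e (p k)))//.
rewrite {1}/p nh /p mul0r addr0 [c + _]addrC subrK -mulr_natl.
by lra.
Qed.

Definition increments_lipschitz (R : realType) (f : R -> R) (c e0 K : R) :
  Prop :=
  forall e x y, 0 < e <= e0 -> `|x| <= c -> `|y| <= c ->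
    `|increment f e x - increment f e y| <= K * e * `|x - y|.

(** For the Lipschitz estimate let r = |x - y|.  The summed inequality is taken
    at s = r or s = - r and for a number n of grid intervals comparable with
    ((d - c) / r)^2, the largest that its hypothesis allows: both s^2 and the
    remainder 2 / n are then of order r^2, and division by s leaves a bound
    of order r. *)
Lemma increment_lipschitz (R : realType) (alpha : \bar R) (f : R -> R)
    (c d e0 : R) :
  Smono 3 alpha f -> 0 < c -> c < d -> 0 < e0 -> ((d + e0)%:E < alpha)%E ->
  exists M K : R, [/\ 0 <= K,
    forall e x, 0 < e <= e0 -> `|x| <= d -> `|increment f e x| <= M * e &
    increments_lipschitz f c e0 K].
Proof.
move=> fm c0 cd e0p da.
set M := 2 * increment f e0 d / e0.
have d0 : 0 <= d by lra.
have dea e : e <= e0 -> ((d + e)%:E < alpha)%E.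
  by move=> ee; rewrite (le_lt_trans _ da)// lee_fin lerD2l.
have id_ge0 e : 0 < e <= e0 -> 0 <= increment f e d.
  move=> /andP[ep ee].
  apply: le_trans (normr_ge0 _)
    (@norm_increment_le _ _ _ e d d fm (ltW ep) (dea _ ee) _).
  by rewrite ger0_norm.
have idM e : 0 < e <= e0 -> increment f e d <= M * e.
  by move=> he; exact: increment_le fm d0 da he.
have M0 : 0 <= M.
  by rewrite divr_ge0 ?(ltW e0p)// mulr_ge0// id_ge0// e0p lexx.
have bound e x : 0 < e <= e0 -> `|x| <= d -> `|increment f e x| <= M * e.
  move=> he xd; apply: le_trans (idM _ he); case/andP: he => ep ee.
  exact: norm_increment_le fm (ltW ep) (dea _ ee) xd.
set L := d - c; have L0 : 0 < L by rewrite subr_gt0.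
exists M, (M * (1 + 2 / L + 1 / L ^+ 2)); split => //.
  by rewrite mulr_ge0// !addr_ge0// ?divr_ge0// ?exprn_ge0// ltW.
move=> e x y he xc yc.
have [->|xy] := eqVneq x y; first by rewrite !subrr normr0 mulr0.
set r := `|x - y|; have r0 : 0 < r by rewrite normr_gt0 subr_eq0.
set D := increment f e x - increment f e y.
have Me0 : 0 <= M * e by rewrite mulr_ge0// ltW//; case/andP: he.
have iL2 : 0 <= 1 / L ^+ 2 by rewrite divr_ge0// exprn_ge0// ltW.
have iL : 0 <= 2 / L by rewrite divr_ge0// ltW.
have -> : M * (1 + 2 / L + 1 / L ^+ 2) * e * r =
   M * e * (r * (1 + 2 / L + 1 / L ^+ 2)) by ring.
(* At distance at least L = d - c the plain bound M e is already enough. *)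
have [rL|Lr] := leP r L; last first.
  apply: (@le_trans _ _ (M * e * 2)).
    have Bx : `|increment f e x| <= M * e by apply: bound => //; lra.
    have By : `|increment f e y| <= M * e by apply: bound => //; lra.
    by rewrite (le_trans (ler_normB _ _))//; lra.
  rewrite ler_wpM2l//.
  have : 2 <= r * (2 / L).
    by rewrite mulrCA ler_peMr// ler_pdivlMr// mul1r ltW.
  by have := mulr_ge0 (ltW r0) iL2; nra.
have [n [n0 nr rn]] : exists n : nat,
    [/\ (0 < n)%N, n%:R <= 2 * L ^+ 2 / r ^+ 2 &
        2 * L ^+ 2 / r ^+ 2 <= 2 * n%:R].
  apply: truncn_half; rewrite ler_pdivlMr ?exprn_gt0// mul1r.
  have : r ^+ 2 <= L ^+ 2 by rewrite lerXn2r ?nnegrE ?(ltW r0) ?(ltW L0).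
  by have := sqr_ge0 L; lra.
have nR : 0 < n%:R :> R by rewrite ltr0n.
move: nr rn; rewrite ler_pdivlMr ?exprn_gt0// ler_pdivrMr ?exprn_gt0// => nr rn.
have r2 : r ^+ 2 = (x - y) ^+ 2 by rewrite real_normK// num_real.
have key s : 0 <= n%:R * (increment f e d * s ^+ 2 + 2 * D * s)
       + 2 * increment f e d.
  case/andP: (he) => ep ee.
  apply: (increment_quadratic_sum_ge0 s fm (ltW ep) (dea _ ee) c0 cd xc yc n0).
  by rewrite -r2.
have id := idM _ he; have id0 := id_ge0 _ he.
have {key} : 2 * (n%:R * r * `|D|) <= M * e * (n%:R * r ^+ 2 + 2).
  apply: (@le_trans _ _ (increment f e d * (n%:R * r ^+ 2 + 2))); last first.
    by rewrite ler_wpM2r// addr_ge0// mulr_ge0// ?sqr_ge0// ltW.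
  have [Dp|Dn] := ler0P D.
    by have := key r; lra.
  by have := key (- r); rewrite sqrrN; lra.
move=> key.
have nr0 : 0 < 2 * (n%:R * r) by rewrite mulr_gt0// mulr_gt0.
rewrite -(ler_pM2l nr0) -[leLHS]mulrA (le_trans key)//.
rewrite [leRHS]mulrCA ler_wpM2l//.
have nL : 1 <= n%:R * r ^+ 2 * (1 / L ^+ 2).
  rewrite mulrA mulr1 ler_pdivlMr ?exprn_gt0// mul1r; lra.
have := mulr_ge0 (mulr_ge0 (ltW nR) (sqr_ge0 r)) iL.
have := mulr_ge0 (ltW nR) (sqr_ge0 r).
move: (2 / L) (1 / L ^+ 2) nL => u v; rewrite expr2; nra.
Qed.
(** * Functions with Lipschitz increments are C^1 *)

(** The slope over the step n eta is the mean of the slopes over the step eta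
    at x, x + eta, ..., each of which is K rho-close to the slope at x. *)
Lemma increment_multiple (R : realType) (f : R -> R) (c e0 K rho x eta : R)
    (n : nat) :
  increments_lipschitz f c e0 K -> 0 <= K -> 0 < eta <= e0 ->
  `|x| + rho <= c -> n%:R * eta <= rho ->
  `|increment f (n%:R * eta) x - n%:R * increment f eta x|
     <= n%:R * eta * (K * rho).
Proof.
move=> fK K0 he xc nrho; case/andP: (he) => ep _.
have rho0 : 0 <= rho by rewrite (le_trans _ nrho)// mulr_ge0// ltW.
have -> : n%:R * increment f eta x = \sum_(0 <= k < n) increment f eta x.
  by rewrite sumr_const_nat subn0 mulr_natl.
rewrite -increment_telescope -sumrB.
have -> : n%:R * eta * (K * rho) = \sum_(0 <= k < n) (K * eta * rho).
  by rewrite sumr_const_nat subn0 -mulr_natl; ring.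
apply: le_trans (ler_norm_sum _ _ _) _.
rewrite big_seq [leRHS]big_seq; apply: ler_sum => k.
rewrite mem_index_iota => /andP[_ kn].
have ke0 : 0 <= k%:R * eta by rewrite mulr_ge0// ltW.
have kr : k%:R * eta <= rho.
  by rewrite (le_trans _ nrho)// ler_pM2r// ler_nat ltnW.
have xk : `|x + k%:R * eta| <= c.
  by rewrite (le_trans (ler_normD _ _))// (ger0_norm ke0); lra.
apply: le_trans (fK _ _ _ he xk _) _; first by lra.
have -> : x + k%:R * eta - x = k%:R * eta by ring.
by rewrite (ger0_norm ke0) ler_wpM2l// mulr_ge0// ltW.
Qed.

(** Lets an error term C / n be dropped from an inequality valid for all n. *)
Lemma ler_add_inv_nat (R : realType) (a b C : R) :
  0 <= C -> (forall n : nat, (0 < n)%N -> a <= b + C / n%:R) -> a <= b.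
Proof.
move=> C0 H; apply/ler_addgt0Pr => e e0.
have Ce : 0 <= C / e by rewrite divr_ge0// ltW.
have /andP[_ Cn] := truncn_itv Ce.
apply: le_trans (H (Num.truncn (C / e)).+1 isT) _.
by rewrite lerD2l ler_pdivrMr ?ltr0n// mulrC -ler_pdivrMr// ltW.
Qed.

(** The slopes over e1 and e2 are compared through the slope over a common
    small step eta = e1 / n.  It divides e1 exactly, and e2 up to a remainder
    less than eta, whose effect on f is at most M eta; hence an error of
    order 1 / n, which disappears because n is arbitrary. *)
Lemma slope_right_cauchy (R : realType) (f : R -> R)
    (c e0 M K rho x e1 e2 : R) :
  increments_lipschitz f c e0 K -> 0 <= K ->
  (forall e y, 0 < e <= e0 -> `|y| <= c -> `|increment f e y| <= M * e) ->
  `|x| + rho <= c -> rho <= e0 -> 0 < e1 <= rho -> 0 < e2 <= rho ->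
  `|increment f e1 x / e1 - increment f e2 x / e2| <= 2 * K * rho.
Proof.
move=> fK K0 fM xc re0 /andP[e1p e1r] /andP[e2p e2r].
have M0 : 0 <= M.
  have h1 : 0 < e1 <= e0 by rewrite e1p (le_trans e1r).
  have x1 : `|x| <= c by lra.
  by have := le_trans (normr_ge0 _) (fM _ _ h1 x1); rewrite pmulr_lge0.
set F := fun e => increment f e x.
have e12 : 0 < e1 * e2 by rewrite mulr_gt0.
(* Without denominators, so that the remaining estimates are polynomial. *)
suff main : `|e2 * F e1 - e1 * F e2| <= 2 * K * rho * (e1 * e2).
  have -> : F e1 / e1 - F e2 / e2 = (e2 * F e1 - e1 * F e2) / (e1 * e2).
    by field; rewrite !gt_eqF.
  by rewrite normrM (gtr0_norm (x := (e1 * e2)^-1)) ?invr_gt0// ler_pdivrMr.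
apply: (@ler_add_inv_nat _ _ _ (2 * M * e1 * e1)).
  by rewrite !mulr_ge0// ltW.
move=> n n0; have nR : 0 < n%:R :> R by rewrite ltr0n.
set eta := e1 / n%:R.
have etap : 0 < eta by rewrite divr_gt0.
have neta : n%:R * eta = e1 by rewrite mulrC divfK// gt_eqF.
have n1 : 1 <= n%:R :> R by rewrite ler1n.
have eta1 : eta <= e1 by rewrite -neta ler_peMl// ltW.
have heta : 0 < eta <= e0 by rewrite etap; lra.
have -> : 2 * M * e1 * e1 / n%:R = 2 * M * e1 * eta by rewrite /eta mulrA.
have Hn : `|F e1 - n%:R * F eta| <= e1 * (K * rho).
  by rewrite -neta; apply: (increment_multiple fK K0 heta xc); rewrite neta.
have e2eta : 0 <= e2 / eta by rewrite divr_ge0// ltW.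
have /andP[] := truncn_itv e2eta.
set q := Num.truncn _; rewrite ler_pdivlMr// ltr_pdivrMr// => qe2 e2q.
rewrite -natr1 mulrDl mul1r in e2q.
have Hq : `|F (q%:R * eta) - q%:R * F eta| <= q%:R * eta * (K * rho).
  by apply: (increment_multiple fK K0 heta xc); lra.
have qeta0 : 0 <= q%:R * eta by rewrite mulr_ge0// ltW.
have He2 : `|F e2 - F (q%:R * eta)| <= M * eta.
  have -> : F e2 - F (q%:R * eta) =
      increment f (e2 - q%:R * eta) (x + q%:R * eta).
    by rewrite /F /increment -[x + _ + _]addrA [_ * _ + _]addrC subrK; ring.
  have [->|ne] := eqVneq e2 (q%:R * eta).
    by rewrite subrr /increment addr0 subrr normr0 mulr_ge0// ltW.
  have dp : 0 < e2 - q%:R * eta by rewrite subr_gt0 lt_neqAle eq_sym ne.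
  apply: le_trans (fM _ _ _ _) _.
  - by rewrite dp; lra.
  - by rewrite (le_trans (ler_normD _ _))// (ger0_norm qeta0); lra.
  - by rewrite ler_wpM2l//; lra.
have HF1 : `|F e1| <= M * e1 by apply: fM; [rewrite e1p; lra|lra].
have -> : e2 * F e1 - e1 * F e2 =
  (e2 - q%:R * eta) * F e1 + q%:R * eta * (F e1 - n%:R * F eta)
  - e1 * (F (q%:R * eta) - q%:R * F eta) - e1 * (F e2 - F (q%:R * eta)).
  have E : q%:R * eta * (n%:R * F eta) = e1 * (q%:R * F eta).
    by rewrite -neta; ring.
  by rewrite [q%:R * eta * (F e1 - _)]mulrBr E; ring.
apply: le_trans (ler_normB _ _) _; rewrite normrM (gtr0_norm e1p).
apply: le_trans (lerD (ler_normB _ _) (lexx _)) _.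
apply: le_trans (lerD (lerD (ler_normD _ _) (lexx _)) (lexx _)) _.
rewrite (normrM (e2 - _)) (normrM (q%:R * eta)) (normrM e1) (gtr0_norm e1p).
rewrite (ger0_norm qeta0) (@ger0_norm _ (e2 - _)) ?subr_ge0//.
have T1 : (e2 - q%:R * eta) * `|F e1| <= eta * (M * e1).
  by rewrite ler_pM// ?subr_ge0//; lra.
have Kr : 0 <= K * rho by rewrite mulr_ge0//; lra.
have T2 : q%:R * eta * `|F e1 - n%:R * F eta| <= e2 * (e1 * (K * rho)).
  by rewrite ler_pM.
have T3 : e1 * `|F (q%:R * eta) - q%:R * F eta| <= e1 * (e2 * (K * rho)).
  rewrite ler_pM2l// (le_trans Hq)// ler_wpM2r//.
have T4 : e1 * `|F e2 - F (q%:R * eta)| <= e1 * (M * eta) by rewrite ler_pM2l.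
lra.
Qed.

(** A slope over a negative step is a slope over a positive step based at
    another point: this is how left and right derivatives are compared. *)
Lemma slope_left (R : realType) (f : R -> R) (h x : R) :
  h < 0 -> increment f h x / h = increment f `|h| (x - `|h|) / `|h|.
Proof.
move=> h0; rewrite (ltr0_norm h0) /increment opprK addrK.
by rewrite invrN mulrN -mulNr opprB.
Qed.

Lemma slope_lipschitz (R : realType) (f : R -> R) (c e0 K h x y : R) :
  increments_lipschitz f c e0 K -> h != 0 -> `|h| <= e0 ->
  `|x| + `|h| <= c -> `|y| + `|h| <= c ->
  `|increment f h x / h - increment f h y / h| <= K * `|x - y|.
Proof.
move=> fK h0 he0 xc yc.
have hp : 0 < `|h| by rewrite normr_gt0.
have pos z w : `|z| <= c -> `|w| <= c ->
    `|increment f `|h| z / `|h| - increment f `|h| w / `|h| |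
    <= K * `|z - w|.
  move=> zc wc; rewrite -mulrBl normrM (@gtr0_norm _ `|h|^-1) ?invr_gt0//.
  rewrite ler_pdivrMr// mulrAC; apply: fK => //.
  by rewrite hp.
move: h0; rewrite neq_lt => /orP[hn|hpos].
  rewrite (slope_left f x hn) (slope_left f y hn).
  have -> : x - y = (x - `|h|) - (y - `|h|) by ring.
  by apply: pos; rewrite (le_trans (ler_normB _ _))// normr_id.
have xc' : `|x| <= c by lra.
have yc' : `|y| <= c by lra.
by have := pos x y xc' yc'; rewrite (gtr0_norm hpos).
Qed.

Lemma slope_cauchy (R : realType) (f : R -> R) (c e0 M K rho x h k : R) :
  increments_lipschitz f c e0 K -> 0 <= K ->
  (forall e y, 0 < e <= e0 -> `|y| <= c -> `|increment f e y| <= M * e) ->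
  `|x| + rho <= c -> rho <= e0 ->
  h != 0 -> `|h| <= rho -> k != 0 -> `|k| <= rho ->
  `|increment f h x / h - increment f k x / k| <= 4 * K * rho.
Proof.
move=> fK K0 fM xc re0 h0 hr k0 kr.
have abs l : l != 0 -> `|l| <= rho ->
    `|increment f l x / l - increment f `|l| x / `|l| | <= K * rho.
  move=> l0 lr; have lp : 0 < `|l| by rewrite normr_gt0.
  have Kr : 0 <= K * rho by rewrite mulr_ge0//; lra.
  move: l0; rewrite neq_lt => /orP[ln|lpos]; last first.
    by rewrite (gtr0_norm lpos) subrr normr0.
  rewrite (slope_left f x ln).
  rewrite -mulrBl normrM (@gtr0_norm _ `|l|^-1) ?invr_gt0// ler_pdivrMr//.
  apply: le_trans (fK _ _ _ _ _ _) _.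
  - by rewrite lp; lra.
  - by rewrite (le_trans (ler_normB _ _))// normr_id; lra.
  - by lra.
  - have -> : x - `|l| - x = - `|l| by ring.
    by rewrite normrN normr_id mulrAC ler_wpM2r// ler_wpM2l.
have Ah := abs _ h0 hr; have Ak := abs _ k0 kr.
have B : `|increment f `|h| x / `|h| - increment f `|k| x / `|k| |
    <= 2 * K * rho.
  by apply: (slope_right_cauchy fK K0 fM xc re0); rewrite normr_gt0; apply/andP.
move: Ah Ak B; rewrite !ler_norml => /andP[? ?] /andP[? ?] /andP[? ?].
by apply/andP; split; lra.
Qed.

Lemma difference_quotientE (R : realType) (f : R -> R) (x : R) :
  (fun h : R => h^-1 *: ((f \o shift x) (h *: (1 : R)) - f x)) =
  (fun h : R => increment f h x / h).
Proof.
apply/funext => h; rewrite /increment /= [h *: 1]mulr1 [h + x]addrC.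
exact: mulrC.
Qed.

Lemma derivable_of_increments (R : realType) (f : R -> R) (c e0 M K x : R) :
  increments_lipschitz f c e0 K -> 0 <= K -> 0 < e0 ->
  (forall e y, 0 < e <= e0 -> `|y| <= c -> `|increment f e y| <= M * e) ->
  `|x| < c -> derivable f x 1.
Proof.
move=> fK K0 e0p fM xc; rewrite /derivable.
rewrite difference_quotientE.
apply/cauchy_cvgP/cauchy_exP => eps eps0.
pose rho := Num.min (Num.min e0 (c - `|x|)) (eps / (4 * K + 1)).
have K1 : 0 < 4 * K + 1 by lra.
have rhop : 0 < rho by rewrite !lt_min e0p subr_gt0 xc divr_gt0.
have r1 : rho <= e0 by rewrite /rho !ge_min lexx.
have r2 : `|x| + rho <= c.
  have : rho <= c - `|x| by rewrite /rho !ge_min lexx orbT.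
  by lra.
have r3 : rho * (4 * K + 1) <= eps.
  by rewrite -ler_pdivlMr// /rho ge_min lexx orbT.
(* Any slope over a step of length at most rho can serve as the centre of
   the ball; the one over rho itself is taken. *)
exists (increment f rho x / rho).
change (\forall h \near 0^', ball (increment f rho x / rho) eps
                             (increment f h x / h)).
near=> h.
have h0 : h != 0 by near: h; exact: nbhs_dnbhs_neq.
have hr : `|h| <= rho by apply: ltW; near: h; exact: dnbhs0_lt.
rewrite /= -ball_normE /=.
apply: (@le_lt_trans _ _ (4 * K * rho)).
  apply: (slope_cauchy fK K0 fM r2 r1) => //; first by rewrite gt_eqF.
  by rewrite gtr0_norm.
by lra.
Unshelve. all: by end_near. Qed.

(** The slopes are K-Lipschitz functions of the base point with K independent
    of the step, so their limit is K-Lipschitz too. *)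
Lemma derive_lipschitz (R : realType) (f : R -> R) (c e0 M K x y : R) :
  increments_lipschitz f c e0 K -> 0 <= K -> 0 < e0 ->
  (forall e y, 0 < e <= e0 -> `|y| <= c -> `|increment f e y| <= M * e) ->
  `|x| < c -> `|y| < c ->
  `|f^`()%classic x - f^`()%classic y| <= K * `|x - y|.
Proof.
move=> fK K0 e0p fM xc yc.
have slope_cvg z : `|z| < c ->
    (increment f h z / h @[h --> 0^']) --> f^`()%classic z.
  move=> zc; have := derivable_of_increments fK K0 e0p fM zc.
  rewrite derive1E /derivable /derive.
  by rewrite difference_quotientE.
have diff_cvg : `|increment f h x / h - increment f h y / h| @[h --> 0^'] -->
    `|f^`()%classic x - f^`()%classic y|.
  by apply: cvg_norm; apply: cvgB; exact: slope_cvg.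
apply: (cvgr_to_le diff_cvg).
near=> h.
apply: (slope_lipschitz fK).
- by near: h; exact: nbhs_dnbhs_neq.
- by apply: ltW; near: h; exact: dnbhs0_lt.
- rewrite -lerBrDl; apply: ltW; near: h; apply: dnbhs0_lt; lra.
- rewrite -lerBrDl; apply: ltW; near: h; apply: dnbhs0_lt; lra.
Unshelve. all: by end_near. Qed.

(** * The theorem *)

(** Room to the right of |x| for the grid interval [c, d] and for steps up to
    e0. *)
Lemma sym_itv_room (R : realType) (alpha : \bar R) (x : R) :
  sym_itv alpha x ->
  exists c d e0 : R, [/\ 0 < c, c < d, 0 < e0, `|x| < c &
    ((d + e0)%:E < alpha)%E].
Proof.
rewrite /sym_itv /= => /andP[ax xa].
have na : (`|x|%:E < alpha)%E.
  by have [x0|x0] := ger0P x; rewrite // EFinN lteNl.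
have x0 := normr_ge0 x.
have [z [xz za]] : exists z : R, `|x| < z /\ (z%:E < alpha)%E.
  case: alpha na {ax xa} => [a| |]; rewrite ?lte_fin//.
    move=> xa; exists ((`|x| + a) / 2); rewrite lte_fin; split; lra.
  by move=> _; exists (`|x| + 1); rewrite ltry; split => //; lra.
pose s := (z - `|x|) / 3.
exists (`|x| + s), (`|x| + 2 * s), s; rewrite /s; split; [lra|lra|lra|lra|].
by congr (_%:E < _)%E: za; field.
Qed.

Theorem proposition2p6 (R : realType) (alpha : \bar R) (f : R -> R) :
  (0 < alpha)%E ->
  Smono 3 alpha f ->
  continuously_differentiable_on (sym_itv alpha) f.
Proof.
move=> _ fm.
have local x : sym_itv alpha x -> exists c e0 M K : R,
    [/\ `|x| < c, 0 < e0, 0 <= K, increments_lipschitz f c e0 K &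
    forall e y, 0 < e <= e0 -> `|y| <= c -> `|increment f e y| <= M * e].
  move=> /sym_itv_room[c [d [e0 [c0 cd e0p xc da]]]].
  have [M [K [K0 fM fK]]] := increment_lipschitz fm c0 cd e0p da.
  exists c, e0, M, K; split => // e y he yc.
  by apply: fM => //; lra.
split=> [x /local[c [e0 [M [K [xc e0p K0 fK fM]]]]]|].
  exact: derivable_of_increments fK K0 e0p fM xc.
apply: continuous_in_subspaceT => x.
rewrite inE => /local[c [e0 [M [K [xc e0p K0 fK fM]]]]].
apply/cvgrPdist_le => eps eps0.
have K1 : 0 < K + 1 by lra.
near=> y.
have yx : `|x - y| <= Num.min (c - `|x|) (eps / (K + 1)) / 2.
  near: y; apply: cvgr_dist_le; first exact: cvg_id.
  by rewrite divr_gt0// lt_min subr_gt0 xc divr_gt0.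
have yc : `|y| < c.
  have : `|x - y| <= (c - `|x|) / 2.
    by rewrite (le_trans yx)// ler_pM2r// ge_min lexx.
  have := ler_normB x (x - y).
  have -> : x - (x - y) = y by ring.
  by lra.
have ye : `|x - y| * (K + 1) <= eps.
  rewrite -ler_pdivlMr// (le_trans yx)// ler_pdivrMr//.
  rewrite (@le_trans _ _ (eps / (K + 1)))// ?ge_min ?lexx ?orbT//.
  by rewrite ler_peMr// ?divr_ge0 ?(ltW eps0) ?(ltW K1)//; lra.
apply: le_trans (derive_lipschitz fK K0 e0p fM xc yc) _.
by have := normr_ge0 (x - y); lra.
Unshelve. all: by end_near. Qed.
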